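(* Let $J$ be an $N\times N$ Jacobi matrix with entries $a_n,b_n\in\mathbb{C}$, $a_n\ne0$, and let $\Omega$ be its generalized spectral function. Let $\lambda_1,\dots,\lambda_p$ be all the distinct eigenvalues of $J$ and $m_1,\dots,m_p$ be their multiplicities, respectively, as roots of the characteristic polynomial $\det(J-\lambda I)$. There exist complex numbers $\beta_{kj}$ ($j=1,\dots,m_k$, $k=1,\dots,p$), uniquely determined by the matrix $J$, such that for any polynomial $G(\lambda)\in\mathbb{C}_{2N}[\lambda]$ the formula $$\langle\Omega,G(\lambda)\rangle=\sum_{k=1}^{p}\sum_{j=1}^{m_k}\frac{\beta_{kj}}{(j-1)!}\,G^{(j-1)}(\lambda_k)$$ holds, where $G^{(n)}(\lambda)$ denotes the $n$th order derivative of $G(\lambda)$ with respect to $\lambda$.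
   Context: $N$ is a positive integer. A (complex) Jacobi matrix $J$ here is an $N\times N$ symmetric tridiagonal matrix (rows and columns indexed $0,\dots,N-1$) with diagonal entries $b_0,\dots,b_{N-1}\in\mathbb{C}$, with nonzero entries $a_n\in\mathbb{C}$ in positions $(n,n+1)$ and $(n+1,n)$ for $0\le n\le N-2$, and zeros elsewhere. Put $a_{N-1}=1$. The polynomials $P_0(\lambda),\dots,P_N(\lambda)$ associated with $J$ are defined by $P_0(\lambda)=1$, $b_0P_0(\lambda)+a_0P_1(\lambda)=\lambda P_0(\lambda)$, $a_{n-1}P_{n-1}(\lambda)+b_nP_n(\lambda)+a_nP_{n+1}(\lambda)=\lambda P_n(\lambda)$ for $n\in\{1,\dots,N-1\}$. $\mathbb{C}_m[\lambda]$ is the space of polynomials of degree $\le m$ with complex coefficients; $\langle\Omega,G(\lambda)\rangle$ denotes the value of the linear functional $\Omega$ at $G$. The generalized spectral function of $J$ is the unique linear functional $\Omega:\mathbb{C}_{2N}[\lambda]\to\mathbb{C}$ such that $\langle\Omega,P_mP_n\rangle=\delta_{mn}$ for $m,n\in\{0,\dots,N-1\}$ and $\langle\Omega,P_mP_N\rangle=0$ for $m\in\{0,\dots,N\}$. *)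

(* Defs.v *)
From mathcomp Require Import all_boot all_order all_algebra.
From mathcomp Require Import reals complex.

Set Implicit Arguments.
Unset Strict Implicit.
Unset Printing Implicit Defensive.

Import GRing.Theory.
Local Open Scope ring_scope.

(* Entries are given by sequences a, b : nat -> C; only a_0, ..., a_{N-2} and
   b_0, ..., b_{N-1} are ever used. *)
Definition jacobi_mx (C : fieldType) (N : nat) (a b : nat -> C) : 'M[C]_N :=
  \matrix_(i < N, j < N)
    if j == i :> nat then b i
    else if j == i.+1 :> nat then a i
    else if i == j.+1 :> nat then a j
    else 0.

(* The convention a_{N-1} = 1. *)
Definition jacobi_coef (C : fieldType) (N : nat) (a : nat -> C) (n : nat) : C :=
  if (n.+1 < N)%N then a n else 1.

(* The three-term recurrence, solved for the polynomial of highest index (see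
   jacobi_poly1 and jacobi_polySS). Meaningful for n <= N. *)
Fixpoint jacobi_poly (C : fieldType) (N : nat) (a b : nat -> C) (n : nat) :
    {poly C} :=
  match n with
  | 0 => 1
  | 1 => (jacobi_coef N a 0)^-1 *: ('X - (b 0%N)%:P)
  | (k.+1 as n').+1 =>
      (jacobi_coef N a n')^-1 *: (('X - (b n')%:P) * jacobi_poly N a b n'
                                  - jacobi_coef N a k *: jacobi_poly N a b k)
  end.

Section Recurrence.
Variables (C : fieldType) (N : nat) (a b : nat -> C).
Hypothesis a_neq0 : forall n, (n.+1 < N)%N -> a n != 0.

Local Notation alpha := (jacobi_coef N a).
Local Notation P := (jacobi_poly N a b).

Lemma jacobi_coef_neq0 n : alpha n != 0.
Proof.
by rewrite /jacobi_coef; case: ifP => [/a_neq0 //|_]; exact: oner_neq0.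
Qed.

Lemma jacobi_poly1 : b 0%N *: P 0 + alpha 0 *: P 1 = 'X * P 0.
Proof.
rewrite /= scalerA mulfV ?jacobi_coef_neq0 // scale1r mulr1.
by rewrite alg_polyC addrC subrK.
Qed.

Lemma jacobi_polySS n :
  alpha n *: P n + b n.+1 *: P n.+1 + alpha n.+1 *: P n.+2 = 'X * P n.+1.
Proof.
have -> : P n.+2 = (alpha n.+1)^-1 *:
    (('X - (b n.+1)%:P) * P n.+1 - alpha n *: P n) by [].
rewrite scalerA mulfV ?jacobi_coef_neq0 // scale1r mulrBl mul_polyC.
by rewrite -[X in _ + X]addrA -opprD [alpha n *: _ + _]addrC subrKC.
Qed.

End Recurrence.

(* {poly_m C} is the space of polynomials of size at most m, i.e., of degree
   less than m. The products P_m P_n below have degree at most 2N, so the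
   truncation npolyp does not alter them. *)
Definition is_generalized_spectral_function (C : fieldType) (N : nat)
    (a b : nat -> C) (Omega : {scalar {poly_(2 * N).+1 C}}) : Prop :=
  (forall m n, (m < N)%N -> (n < N)%N ->
     Omega (npolyp _ (jacobi_poly N a b m * jacobi_poly N a b n))
     = (m == n)%:R) /\
  (forall m, (m <= N)%N ->
     Omega (npolyp _ (jacobi_poly N a b m * jacobi_poly N a b N)) = 0).

Definition char_det (C : fieldType) (N : nat) (J : 'M[C]_N) : {poly C} :=
  \det (map_mx polyC J - 'X%:M).

(* Main.v *)
(* Up to a nonzero constant, det(J - X) is P_N. Since Omega kills P_N Q whenever
   deg Q <= N, <Omega, G> depends only on G mod P_N. On polynomials of degree
   less than N, taking the Taylor coefficients of order < m_k at each lambda_k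
   is injective, because a polynomial with zero data is divisible by P_N; as
   m_1 + ... + m_p = N it is bijective, so every functional there is a unique
   combination of these coefficients. *)
Require Import Defs.
From mathcomp Require Import all_boot all_order all_algebra.
From mathcomp Require Import reals complex.
From mathcomp Require Import boolp ring.

Set Implicit Arguments.
Unset Strict Implicit.
Unset Printing Implicit Defensive.

Import GRing.Theory Num.Theory.
Local Open Scope ring_scope.

(** * Taylor coefficients at a point and divisibility by powers of a linear factor *)

Lemma coef_comp_XaddC (F : fieldType) (G : {poly F}) (c : F) (j : nat) :
  (G \Po ('X + c%:P))`_j = G^`N(j).[c].
Proof.
have -> : G \Po ('X + c%:P) = \poly_(i < size G) G^`N(i).[c].
  rewrite addrC /comp_poly (nderiv_taylor _ (mulrC _ _)) size_map_polyC.
  rewrite poly_def; apply: eq_bigr => i _.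
  by rewrite nderivn_map horner_map /= mul_polyC.
rewrite coef_poly; case: ltnP => // leGj.
by rewrite nderivn_poly0 // horner0.
Qed.

(** Translation by [c] turns [('X - c%:P) ^+ m] into ['X^m], and divisibility by ['X^m] means that
    the first [m] coefficients vanish. Divided derivatives make this valid in any characteristic. *)
Lemma dvdp_XsubC_expP (F : fieldType) (G : {poly F}) (c : F) (m : nat) :
  reflect (forall j, (j < m)%N -> G^`N(j).[c] = 0) (('X - c%:P) ^+ m %| G).
Proof.
apply: (iffP idP) => [/dvdpP[q ->] j ltjm|G0].
  rewrite -coef_comp_XaddC comp_polyM rmorphXn /=.
  by rewrite comp_polyB comp_polyX comp_polyC addrK coefMXn ltjm.
have GK : G = (G \Po ('X + c%:P)) \Po ('X - c%:P).
  by rewrite -comp_polyA comp_polyD comp_polyX comp_polyC subrK comp_polyXr.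
rewrite GK -(poly_take_drop m (G \Po _)).
suff -> : take_poly m (G \Po ('X + c%:P)) = 0.
  by rewrite add0r comp_polyM rmorphXn /= comp_polyX dvdp_mull.
apply/polyP => j; rewrite coef_take_poly coef0; case: ifP => // /G0.
by rewrite coef_comp_XaddC.
Qed.

(** * Products of powers of distinct linear factors *)

Section CoprimePowers.
Variables (F : fieldType) (I : finType) (z : I -> F) (m : I -> nat).
Hypothesis z_inj : injective z.

(** Induction with Gauss's lemma: the factor at [z i] is coprime to the others because [z i] is not
    a root of them. *)
Lemma dvdp_prod_XsubC_exp (G : {poly F}) :
  (\prod_i ('X - (z i)%:P) ^+ m i %| G)
  = [forall i, ('X - (z i)%:P) ^+ m i %| G].
Proof.
suff H (r : seq I) : uniq r -> (\prod_(i <- r) ('X - (z i)%:P) ^+ m i %| G)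
    = all (fun i => ('X - (z i)%:P) ^+ m i %| G) r.
  rewrite H ?index_enum_uniq //; apply/allP/forallP => h i; last by move=> _; exact: h.
  by apply: h; rewrite mem_index_enum.
elim: r => [|i r IH] /=; first by rewrite big_nil dvd1p.
case/andP=> inr ur; rewrite big_cons Gauss_dvdp ?IH //.
rewrite coprimep_expl // coprimep_sym coprimep_XsubC rootE.
rewrite horner_prod prodf_seq_neq0; apply/allP => j jr /=.
rewrite horner_exp expf_neq0 // !hornerE subr_eq0.
by apply: contraNneq inr => /z_inj->.
Qed.

Lemma size_prod_XsubC_exp :
  size (\prod_i ('X - (z i)%:P) ^+ m i) = (\sum_i m i).+1.
Proof.
rewrite size_prod => [|i _]; last by rewrite expf_neq0 // polyXsubC_eq0.
under eq_bigr do rewrite size_exp_XsubC -addn1.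
rewrite big_split /= sum1_card -addSn.
by rewrite addnK.
Qed.

End CoprimePowers.

(** * Families with one polynomial in each degree *)

Section GradedFamily.
Variables (F : fieldType) (P : nat -> {poly F}) (n : nat).
Hypothesis size_P : forall i, (i < n)%N -> size (P i) = i.+1.

Definition coef_mx : 'M[F]_n := \matrix_(i, j) (P i)`_j.

(** The matrix is lower triangular with the nonzero leading coefficients on its diagonal. *)
Lemma coef_mx_unit : coef_mx \in unitmx.
Proof.
rewrite unitmxE det_trig ?unitfE; last first.
  by apply/is_trig_mxP => i j ltij; rewrite mxE nth_default // size_P.
apply/prodf_neq0 => i _; rewrite mxE.
have := lead_coefE (P i); rewrite size_P // => <-.
by rewrite lead_coef_eq0 -size_poly_eq0 size_P.
Qed.

Lemma graded_span (Q : {poly F}) : (size Q <= n)%N ->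
  exists u : 'rV[F]_n, Q = \sum_i u 0 i *: P i.
Proof.
move=> leQn; exists (poly_rV Q *m invmx coef_mx).
set u := _ *m _; have Eu : u *m coef_mx = poly_rV Q.
  by rewrite mulmxKV // coef_mx_unit.
apply/polyP => j; case: (ltnP j n) => [ltjn|lenj]; last first.
  rewrite !nth_default ?(leq_trans leQn) //.
  apply: leq_trans (size_sum _ _ _) _; apply/bigmax_leqP => i _.
  apply: leq_trans (size_scale_leq _ _) _.
  by rewrite size_P // (leq_trans _ lenj).
have /rowP/(_ (Ordinal ltjn)) := Eu; rewrite 2!mxE /= => <-.
by rewrite coef_sum; apply: eq_bigr => i _; rewrite coefZ [coef_mx _ _]mxE.
Qed.

End GradedFamily.

(** * The polynomials P_n and the characteristic determinant *)

Section JacobiPoly.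
Variables (C : fieldType) (N : nat) (a b : nat -> C).
Hypothesis a_neq0 : forall n, (n.+1 < N)%N -> a n != 0.

Local Notation alpha := (jacobi_coef N a).
Local Notation P := (jacobi_poly N a b).
Local Notation A := (map_mx polyC (jacobi_mx N a b) - 'X%:M).

Lemma size_jacobi_poly n : size (P n) = n.+1.
Proof.
suff [] : size (P n) = n.+1 /\ size (P n.+1) = n.+2 by [].
elim: n => [|n [IH1 IH2]].
  by rewrite /= size_poly1 size_scale ?invr_eq0 ?jacobi_coef_neq0 ?size_XsubC.
split=> //.
have -> : P n.+2 = (alpha n.+1)^-1 *:
    (('X - (b n.+1)%:P) * P n.+1 - alpha n *: P n) by [].
rewrite size_scale ?invr_eq0 ?jacobi_coef_neq0 //.
have sXP : size (('X - (b n.+1)%:P) * P n.+1) = n.+3.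
  by rewrite size_mul ?polyXsubC_eq0 -?size_poly_eq0 ?IH2 ?size_XsubC.
by rewrite size_polyDl sXP // size_polyN size_scale ?jacobi_coef_neq0 // IH1.
Qed.

(** Row [i] is the recurrence at index [i]; the last row lacks the term in [P N], as there is no
    column [N]. *)
Lemma jacobi_mx_poly (i : 'I_N) :
  \sum_j A i j * P j = if i.+1 == N then - P N else 0.
Proof.
have E (j : 'I_N) : A i j * P j
   = (if j == i :> nat then b i *: P j - 'X * P j else 0)
   + (if j == i.+1 :> nat then a i *: P j else 0)
   + (if i == j.+1 :> nat then a j *: P j else 0).
  rewrite !mxE -val_eqE /= [i == j :> nat]eq_sym.
  case: (ltngtP j i) => [ltji|ltij|->]; last 1 first.
  - by rewrite !ltn_eqF // mulr1n mulrBl mul_polyC !addr0.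
  - rewrite [j == i.+1 :> nat]ltn_eqF ?(leq_trans ltji) // mulr0n subr0 !add0r.
    by case: ifP; rewrite mul_polyC ?scale0r.
  rewrite mulr0n subr0 add0r [i == j.+1 :> nat]ltn_eqF ?(leq_trans ltij) //.
  rewrite addr0.
  by case: ifP; rewrite mul_polyC ?scale0r.
rewrite (eq_bigr _ (fun j _ => E j)) !big_split /= -!big_mkcond /=.
rewrite (big_ord1_eq _ (fun j => b i *: P j - 'X * P j)) ltn_ord.
rewrite (big_ord1_eq _ (fun j => a i *: P j)).
(* In the last row the convention a_{N-1} = 1 makes the missing term exactly [P N]. *)
have -> : (if (i.+1 < N)%N then a i *: P i.+1 else 0)
  = alpha i *: P i.+1 + (if i.+1 == N then - P N else 0).
  rewrite /jacobi_coef; case: (ltngtP i.+1 N) => [_|ltNi|->].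
  - by rewrite addr0.
  - by have := leq_trans ltNi (ltn_ord i); rewrite ltnn.
  by rewrite scale1r subrr.
case: i {E} => [[|i] ltiN] /=.
  rewrite big1 ?addr0 //.
  have := jacobi_poly1 b a_neq0; rewrite -/(P 1) => <-.
  by rewrite addrA opprD addrA subrr sub0r addNr add0r.
under eq_bigl do rewrite eqSS eq_sym.
rewrite (big_ord1_eq _ (fun j => a j *: P j)) (ltn_trans _ ltiN) //.
have -> : a i = alpha i by rewrite /jacobi_coef ltiN.
rewrite -/(P i.+2) -/(P i.+1) -(jacobi_polySS b a_neq0 i).
set x := alpha i *: P i; set t := alpha i.+1 *: _; ring.
Qed.

End JacobiPoly.

(* Cramer: with u = (P_0, ..., P_n), A u = - P_{n+1} e_n and u_0 = 1, so that
   det A is - P_{n+1} times the (n, 0) cofactor, whose minor is triangular with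
   diagonal a_0, ..., a_{n-1}. *)
Lemma char_det_jacobi (C : fieldType) (N : nat) (a b : nat -> C) :
  (forall n, (n.+1 < N)%N -> a n != 0) ->
  char_det (jacobi_mx N a b) %= jacobi_poly N a b N.
Proof.
case: N => [|n] a_neq0; first by rewrite /char_det det_mx00 eqpxx.
set P := jacobi_poly n.+1 a b; rewrite /char_det; set A := _ - _.
pose u := \col_(j < n.+1) P j.
have Au : A *m u = \col_i (if i == ord_max then - P n.+1 else 0).
  apply/colP => i; rewrite !mxE -(jacobi_mx_poly b a_neq0 i).
  by apply: eq_bigr => j _; rewrite [u _ _]mxE.
have /colP/(_ 0) : \adj A *m A *m u = (\det A)%:M *m u by rewrite mul_adj_mx.
rewrite -mulmxA Au mul_scalar_mx !mxE mulr1 => <-.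
rewrite (bigD1 ord_max) //= big1 => [|i /negPf ni]; last first.
  by rewrite !mxE ni mulr0.
rewrite !mxE eqxx addr0 /cofactor det_trig; last first.
  (* Deleting the last row and column 0 puts entry (i, j+1) of [A] in position (i, j); it vanishes
     for j > i. *)
  apply/is_trig_mxP => i j ltij; rewrite !mxE -val_eqE /= /bump
     [(n <= i)%N]leqNgt ltn_ord /= add1n add0n.
  have lt1 : (i < j.+1)%N by exact: ltnW.
  have lt2 : (i < j.+2)%N by exact: ltnW.
  rewrite (gtn_eqF lt1) eqSS (gtn_eqF ltij) (ltn_eqF lt2) (ltn_eqF lt1).
  by rewrite mulr0n subr0.
rewrite mulrN -mulNr.
set c := - _; suff [d d0 ->] : exists2 d, d != 0 & c = d%:P.
  by rewrite mul_polyC eqp_scale.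
exists (- ((-1) ^+ (n + 0) * \prod_(i < n) a i)).
  rewrite oppr_eq0 mulf_neq0 ?signr_eq0 //; apply/prodf_neq0 => i _.
  by rewrite a_neq0 // ltnS.
rewrite /c polyCN polyCM rmorph_sign rmorph_prod /=; congr (- (_ * _)).
apply: eq_bigr => i _; rewrite !mxE -val_eqE /= /bump
  [(n <= i)%N]leqNgt ltn_ord /= add1n add0n.
by rewrite (gtn_eqF (ltnSn i)) eqxx (ltn_eqF (ltnSn i)) mulr0n subr0.
Qed.

(** * Factorization of the characteristic determinant over the eigenvalues *)

Lemma char_detE (C : fieldType) (N : nat) (J : 'M[C]_N) :
  char_det J = (-1) ^+ N *: char_poly J.
Proof.
rewrite /char_poly /char_poly_mx /char_det -[_ - 'X%:M]opprB -scaleN1r.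
by rewrite detZ -(rmorph_sign polyC) mul_polyC.
Qed.

(** If the cofactor of the product were not constant, it would have a root; this root is some
    eigenvalue [z k], whose multiplicity would then exceed itself. *)
Lemma char_det_prod (C : closedFieldType) (N : nat) (J : 'M[C]_N)
    (I : finType) (z : I -> C) (z_inj : injective z)
    (z_eigen : forall x, eigenvalue J x <-> exists k, z k = x) :
  char_det J %= \prod_k ('X - (z k)%:P) ^+ mup (z k) (char_det J).
Proof.
have size_chi : size (char_det J) = N.+1.
  by rewrite char_detE size_scale ?signr_eq0 // size_char_poly.
have chi_neq0 : char_det J != 0 by rewrite -size_poly_eq0 size_chi.
set q := \prod_k _; have : q %| char_det J.
  by rewrite dvdp_prod_XsubC_exp //; apply/forallP => k; rewrite -mup_geq.
case/dvdpP => s chiE.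
suff s1 : size s == 1%N.
  have [c c_neq0 sE] := size_poly1P s s1.
  by rewrite chiE sE mul_polyC eqp_scale.
apply/negPn/negP => /closed_rootP[x sx].
have : eigenvalue J x.
  have s0 : (-1) ^+ N != 0 :> C by rewrite signr_eq0.
  rewrite eigenvalue_root_char -(rootZ x _ s0) -char_detE chiE.
  by rewrite rootM sx.
case/z_eigen => k zk.
have := mup_geq x (mup x (char_det J)).+1 chi_neq0.
rewrite ltnn => /esym/negP; apply.
rewrite [X in _ %| X]chiE exprS dvdp_mul // ?dvdp_XsubCl //.
by rewrite /q (bigD1 k) //= zk dvdp_mulr.
Qed.

(** * Functionals as combinations of Hermite data *)

(** The vector [w] holds the values of a functional on the monomials. The equivalence gives
    existence (take [beta' = beta]) and uniqueness at once. *)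
Lemma hermite_functional (F : fieldType) (I : finType) (z : I -> F)
    (m : I -> nat) (n : nat) (w : 'cV[F]_n) :
    injective z -> (\sum_k m k)%N = n ->
  exists beta : forall k, 'I_(m k) -> F,
    forall beta' : forall k, 'I_(m k) -> F,
    (forall G : {poly F}, (size G <= n)%N ->
       \sum_i w i 0 * G`_i
       = \sum_k \sum_(j < m k) beta' k j * G^`N(j).[z k])
    <-> beta = beta'.
Proof.
move=> z_inj sum_m.
(* The pairs (k, j) are flattened into one index type, so that the coefficients form a column
   vector. *)
pose T := {k : I & 'I_(m k)}.
have cardT : #|{: T}| = n.
  rewrite -sum_m -sum1_card.
  rewrite -(sig_big_dep (fun=> true) (fun _ _ => true) (fun _ _ => 1%N)) /=.
  by apply: eq_bigr => k _; rewrite sum1_card card_ord.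
pose herm (s : 'I_#|{: T}|) (G : {poly F}) :=
  G^`N(tagged (enum_val s)).[z (tag (enum_val s))].
pose H : 'M[F]_(n, #|{: T}|) := \matrix_(i, s) herm s 'X^i.
have HE v s : (v *m H) 0 s = herm s (rVpoly v).
  rewrite mxE /herm.
  have -> : rVpoly v = \sum_(i < n) v 0 i *: 'X^i.
    rewrite /rVpoly poly_def; apply: eq_bigr => i _.
    by rewrite valK.
  rewrite linear_sum horner_sum; apply: eq_bigr => i _.
  by rewrite linearZ hornerZ mxE.
have freeH : row_free H.
  apply: inj_row_free => v vH.
  suff v0 : rVpoly v = 0 by rewrite -[v]rVpolyK v0 linear0.
  have sv : (size (rVpoly v) <= n)%N by exact: size_poly.
  apply/eqP/negPn/negP => /dvdp_leq le_size.
  have /le_size : \prod_k ('X - (z k)%:P) ^+ m k %| rVpoly v; last first.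
    by rewrite size_prod_XsubC_exp sum_m ltnNge sv.
  rewrite dvdp_prod_XsubC_exp //; apply/forallP => k.
  apply/dvdp_XsubC_expP => j ltj.
  have := HE v (enum_rank (Tagged (fun k => 'I_(m k)) (Ordinal ltj) : T)).
  by rewrite vH mxE /herm enum_rankK /= => ->.
have fullH : row_full H.
  by move: freeH; rewrite /row_free /row_full => /eqP->; rewrite cardT.
(* [H] is square only up to the equality [cardT], hence separate right and left inverses. *)
have [B HB] := row_freeP freeH; have [B' B'H] := row_fullP fullH.
pose col_of (beta : forall k, 'I_(m k) -> F) : 'cV[F]_#|{: T}| :=
  \col_s beta (tag (enum_val s)) (tagged (enum_val s)).
have sumE beta (v : 'rV_n) :
    \sum_k \sum_(j < m k) beta k j * (rVpoly v)^`N(j).[z k]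
    = (v *m (H *m col_of beta)) 0 0.
  rewrite (sig_big_dep _ _ (fun k (j : 'I_(m k)) =>
    beta k j * (rVpoly v)^`N(j).[z k])) /=.
  rewrite (reindex (@enum_val T predT)) /=; last first.
    by exists enum_rank => t _; rewrite ?enum_valK ?enum_rankK.
  rewrite mulmxA mxE; apply: eq_bigr => s _.
  by rewrite HE [col_of _ _ _]mxE mulrC.
have iffH beta : (forall G : {poly F}, (size G <= n)%N ->
     \sum_i w i 0 * G`_i = \sum_k \sum_(j < m k) beta k j * G^`N(j).[z k])
    <-> H *m col_of beta = w.
  split=> [eqG|Hw G sG].
    (* Testing on the i-th basis row amounts to taking G = X^i. *)
    apply/row_matrixP => i; rewrite !rowE; apply/rowP => j; rewrite ord1 -sumE.
    rewrite -eqG ?size_poly // mxE; apply: eq_bigr => k _.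
    by rewrite mulrC coef_rVpoly_ord.
  rewrite -(poly_rV_K sG) sumE Hw mxE; apply: eq_bigr => i _.
  by rewrite poly_rV_K // mxE mulrC.
pose bc := B *m w.
exists (fun k j => bc (enum_rank (Tagged (fun k => 'I_(m k)) j : T)) 0) => beta'.
set beta := fun k => _.
have colB : col_of beta = bc.
  apply/colP => s; rewrite mxE /beta; congr (bc _ 0).
  by rewrite -[RHS]enum_valK; congr enum_rank; case: (enum_val s).
split=> [/iffH Hw|<-]; last by apply/iffH; rewrite colB mulmxA HB mul1mx.
apply: functional_extensionality_dep => k.
apply: functional_extensionality_dep => j.
rewrite /beta; have -> : bc = col_of beta'.
  rewrite -[LHS]mul1mx -[RHS]mul1mx -B'H -!mulmxA Hw.
  by rewrite /bc [H *m _]mulmxA HB mul1mx.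
by rewrite mxE enum_rankK.
Qed.

(** * Reduction of the spectral function modulo P_N *)

Section SpectralFunction.
Variables (C : fieldType) (N : nat) (a b : nat -> C).
Hypothesis a_neq0 : forall n, (n.+1 < N)%N -> a n != 0.

Local Notation P := (jacobi_poly N a b).

(* The moments <Omega, X^i> for i < N: the equations <Omega, P_i> = delta_{i0}
   read coef_mx P N *m moments = e_0. *)
Definition moments : 'cV[C]_N :=
  invmx (coef_mx P N) *m \col_i (i == 0%N :> nat)%:R.

(** In G = q P_N + r, expand q in P_0, ..., P_N and r in P_0, ..., P_{N-1}. The first part is killed
    by [Omega]; on the second, P_i = P_i P_0 has value delta_{i0}. *)
Lemma spectral_function_modp (Omega : {scalar {poly_(2 * N).+1 C}})
    (G : {poly_(2 * N).+1 C}) :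
    (0 < N)%N -> is_generalized_spectral_function a b Omega ->
  Omega G = \sum_i moments i 0 * (polyn G %% P N)`_i.
Proof.
move=> N_gt0 [orthP orthPN].
have sizeP n : size (P n) = n.+1 by exact: size_jacobi_poly.
have L_sum n (c : 'rV[C]_n) (Q : nat -> {poly C}) :
    Omega (npolyp _ (\sum_i c 0 i *: Q i))
    = \sum_i c 0 i * Omega (npolyp _ (Q i)).
  transitivity (Omega (\sum_i c 0 i *: npolyp _ (Q i))).
    congr (Omega _); apply: val_inj; apply/polyP => j.
    rewrite coef_npolyp coefn_sum coef_sum; case: ifP => ltj.
      by apply: eq_bigr => i _; rewrite !coefZ coef_npolyp ltj.
    by rewrite big1 // => i _; rewrite coefZ coef_npolyp ltj mulr0.
  by rewrite linear_sum; apply: eq_bigr => i _; rewrite linearZ.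
have PN_neq0 : P N != 0 by rewrite -size_poly_eq0 sizeP.
have [u uE] : exists u : 'rV[C]_N.+1, polyn G %/ P N = \sum_i u 0 i *: P i.
  apply: graded_span => [i _|]; first exact: sizeP.
  by rewrite size_divp // sizeP leq_subLR (leq_trans (size_npoly G)) //
    mul2n -addnn addnS.
have [v vE] : exists v : 'rV[C]_N, polyn G %% P N = \sum_i v 0 i *: P i.
  apply: graded_span => [i _|]; first exact: sizeP.
  by rewrite -ltnS -(sizeP N) ltn_modp.
have GE : G = npolyp _ (\sum_i u 0 i *: (P i * P N))
            + npolyp _ (\sum_i v 0 i *: (P i * P 0%N)).
  apply: val_inj; rewrite [RHS](raddfD (@polyn C (2 * N).+1)); apply/polyP => j.
  rewrite /= coefD !coef_npolyp.
  (* Truncation is harmless: beyond degree 2N the coefficients of [G] vanish too. *)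
  case: ltnP => [_|lej]; last first.
    by rewrite addr0 nth_default // (leq_trans (size_npoly G)).
  rewrite -coefD {1}(divp_eq (polyn G) (P N)) uE vE mulr_suml.
  apply: (congr1 (fun q : {poly C} => q`_j)); congr (_ + _);
    apply: eq_bigr => i _; first by rewrite scalerAl.
  by rewrite /= mulr1.
rewrite [in LHS]GE linearD (L_sum _ u (fun i => P i * P N)).
rewrite (L_sum _ v (fun i => P i * P 0%N)).
rewrite [X in X + _]big1 ?add0r => [|i _]; last first.
  by rewrite orthPN ?mulr0 // -ltnS.
under eq_bigr do rewrite orthP //.
have coefM : coef_mx P N *m moments = \col_i (i == 0%N :> nat)%:R.
  by rewrite mulKVmx // coef_mx_unit.
(* Replacing delta_{i0} by row i of the moment equations and exchanging sums recovers the
   coefficients of r. *)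
transitivity (\sum_(i < N) v 0 i * (coef_mx P N *m moments) i 0).
  by apply: eq_bigr => i _; rewrite coefM mxE.
rewrite vE; under [RHS]eq_bigr do rewrite coef_sum mulr_sumr.
rewrite exchange_big /=; apply: eq_bigr => i _; rewrite mxE mulr_sumr.
by apply: eq_bigr => j _; rewrite [coef_mx P N i j]mxE coefZ mulrA mulrC.
Qed.

End SpectralFunction.

Theorem theorem4 (R : realType) (N : nat) (N_gt0 : (0 < N)%N)
    (a b : nat -> R[i])
    (a_neq0 : forall n : nat, (n.+1 < N)%N -> a n != 0)
    (p : nat) (lambda : 'I_p -> R[i]) (m : 'I_p -> nat)
    (lambda_inj : injective lambda)
    (lambda_eigen : forall z : R[i],
       eigenvalue (jacobi_mx N a b) z <-> exists k : 'I_p, lambda k = z)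
    (m_mult : forall k : 'I_p,
       m k = mup (lambda k) (char_det (jacobi_mx N a b))) :
  exists beta : forall k : 'I_p, 'I_(m k) -> R[i],
    forall Omega : {scalar {poly_(2 * N).+1 R[i]}},
      is_generalized_spectral_function a b Omega ->
      unique (fun beta' : forall k : 'I_p, 'I_(m k) -> R[i] =>
        forall G : {poly_(2 * N).+1 R[i]},
          Omega G = \sum_(k < p) \sum_(j < m k)
            beta' k j / (j`!)%:R * ((G : {poly R[i]})^`(j)).[lambda k]) beta.
Proof.
set P := jacobi_poly N a b.
have sizeP n : size (P n) = n.+1 by exact: size_jacobi_poly.
have P_prod : P N %= \prod_k ('X - (lambda k)%:P) ^+ m k.
  rewrite -(eqp_ltrans (char_det_jacobi b a_neq0)).
  under [X in _ %= X]eq_bigr do rewrite m_mult.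
  exact: char_det_prod.
have sum_m : (\sum_k m k)%N = N.
  apply: succn_inj; rewrite -(size_prod_XsubC_exp lambda m) -(sizeP N).
  exact/esym/eqp_size.
(* These coefficients come from [moments], so they are fixed before any [Omega] is given. *)
have [beta betaP] := hermite_functional (moments N a b) lambda_inj sum_m.
exists beta => Omega OmegaP.
(* With [j] counted from 0, dividing by j! (nonzero in characteristic 0) gives the divided
   derivative. *)
have taylorE (beta' : forall k, 'I_(m k) -> R[i]) (G : {poly R[i]}) :
    \sum_(k < p) \sum_(j < m k) beta' k j / (j`!)%:R * G^`(j).[lambda k]
    = \sum_(k < p) \sum_(j < m k) beta' k j * G^`N(j).[lambda k].
  apply: eq_bigr => k _; apply: eq_bigr => j _.
  rewrite nderivn_def hornerMn -[X in _ * X]mulr_natl mulrA divfK //.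
  by rewrite pnatr_eq0 -lt0n fact_gt0.
(* [G] and its remainder differ by a multiple of [P N], which vanishes to order [m k] at
   [lambda k]. *)
have hermE (G : {poly R[i]}) (k : 'I_p) (j : 'I_(m k)) :
    G^`N(j).[lambda k] = (G %% P N)^`N(j).[lambda k].
  apply/eqP; rewrite -subr_eq0 -hornerN -hornerD -nderivnB; apply/eqP.
  have : P N %| G - G %% P N by rewrite {1}(divp_eq G (P N)) addrK dvdp_mull.
  rewrite (eqp_dvdl _ P_prod) dvdp_prod_XsubC_exp // => /forallP/(_ k).
  by move/dvdp_XsubC_expP; apply.
split=> [G|beta' beta'E].
  rewrite (spectral_function_modp a_neq0 _ N_gt0 OmegaP) taylorE.
  rewrite (proj2 (betaP beta) erefl).
    by apply: eq_bigr => k _; apply: eq_bigr => j _; rewrite [in RHS]hermE.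
  by rewrite -ltnS -(sizeP N) ltn_modp -size_poly_eq0 sizeP.
(* For uniqueness, polynomials of degree below N suffice: each lies in the domain of [Omega] and is
   its own remainder. *)
apply/betaP => G sG.
have sG' : (size G <= (2 * N).+1)%N.
  by rewrite (leq_trans sG) // leqW // leq_pmull.
have := beta'E (npolyp _ G); rewrite taylorE npolypK // => <-.
rewrite (spectral_function_modp a_neq0 _ N_gt0 OmegaP) npolypK //.
by rewrite modp_small // sizeP ltnS.
Qed.
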